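(* Let $\Gamma$ be a discrete group. The kernel of the comparison map $H^2_{(1)}(\Gamma;\mathbf{R})\to H^2(\Gamma;\mathbf{R})$ is isomorphic (as a real vector space) to the quotient of the space of abstractly Lipschitz functions on $\Gamma$ by the sum of the space of homomorphisms $\Gamma\to\mathbf{R}$ and the space of bounded functions $\Gamma\to\mathbf{R}$.
   Context: $C^n(\Gamma;\mathbf{R})$ is the space of all functions $\Gamma^n\to\mathbf{R}$ (nonhomogeneous cochains, trivial coefficients) with codifferential $$\delta\alpha(g_1,\dots,g_{n+1})=\alpha(g_2,\dots,g_{n+1})+\sum_{k=1}^{n}(-1)^k\alpha(g_1,\dots,g_kg_{k+1},\dots,g_{n+1})+(-1)^{n+1}\alpha(g_1,\dots,g_n).$$ For $n\ge1$, $\omega\in C^n(\Gamma;\mathbf{R})$ is called 1-bounded if for all fixed $g_2,\dots,g_n\in\Gamma$ the function $g_1\mapsto\omega(g_1,g_2,\dots,g_n)$ is bounded; in degree $0$ all cochains are 1-bounded. The 1-bounded cochains form a subcomplex $C^*_{(1)}(\Gamma;\mathbf{R})$ with cohomology $H^*_{(1)}(\Gamma;\mathbf{R})$; the comparison map is induced by the inclusion $C^*_{(1)}(\Gamma;\mathbf{R})\subseteq C^*(\Gamma;\mathbf{R})$. A function $\phi\colon\Gamma\to\mathbf{R}$ is called abstractly Lipschitz if for each fixed $h\in\Gamma$ one has $\sup_{g\in\Gamma}|\phi(gh)-\phi(g)|<\infty$. *)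

(* Defs.v *)
From HB Require Import structures.
From mathcomp Require Import all_boot all_order all_algebra.
From mathcomp Require Import zify.
From mathcomp Require Import boolp classical_sets functions reals.
From mathcomp Require Import topology normedtype.

Set Implicit Arguments.
Unset Strict Implicit.
Unset Printing Implicit Defensive.

Import Order.TTheory GRing.Theory Num.Theory.
Import numFieldNormedType.Exports.

Local Open Scope classical_set_scope.
Local Open Scope ring_scope.
Local Open Scope quotient_scope.

Section Subspaces.
Variables (R : pzRingType) (V : lmodType R).

Definition subspace (S : submodClosed V) := {v : V | v \in S}.
HB.instance Definition _ (S : submodClosed V) := SubChoice.on (subspace S).
HB.instance Definition _ (S : submodClosed V) :=
  [SubChoice_isSubLmodule of subspace S by <:].

(* Over a ring, closure under scaling gives closure under opposite, but
   submodClosed (stated over semirings) does not inherit from zmodClosed, which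
   Quotient.quot expects; as_zmod S is S with this structure added. *)
Definition as_zmod (S : submodClosed V) : {pred V} := S.
Fact as_zmod_closed (S : submodClosed V) : zmod_closed (as_zmod S).
Proof. exact: (GRing.subsemimod_closedB (GRing.subsemimodClosedP S)). Qed.
HB.instance Definition _ (S : submodClosed V) :=
  GRing.isZmodClosed.Build V (as_zmod S) (as_zmod_closed S).

Definition lquot (S : submodClosed V) := Quotient.quot (as_zmod S).
HB.instance Definition _ (S : submodClosed V) := GRing.Zmodule.on (lquot S).
HB.instance Definition _ (S : submodClosed V) := Quotient.on (lquot S).

Section LmodQuotient.
Variable S : submodClosed V.

Definition lquot_pi (v : V) : lquot S := \pi_(lquot S) v.

Lemma lquot_piE u v : lquot_pi u = lquot_pi v <-> u - v \in S.
Proof. by split=> [/eqP|H]; [|apply/eqP]; rewrite -Quotient.idealrBE. Qed.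

Lemma lquot_pi_repr (x : lquot S) : lquot_pi (repr x) = x.
Proof. exact: reprK. Qed.

Lemma lquot_piD u v : lquot_pi (u + v) = lquot_pi u + lquot_pi v.
Proof. by rewrite /lquot_pi; exact: (Quotient.pi_add (as_zmod S) u v). Qed.

Definition lquot_scale (a : R) (x : lquot S) : lquot S :=
  lquot_pi (a *: repr x).

Lemma lquot_scale_pi a v : lquot_scale a (lquot_pi v) = lquot_pi (a *: v).
Proof.
apply/lquot_piE; rewrite -scalerBr rpredZ//.
by apply/lquot_piE; rewrite lquot_pi_repr.
Qed.

Fact lquot_scaleA a b x :
  lquot_scale a (lquot_scale b x) = lquot_scale (a * b) x.
Proof. by rewrite -[x]lquot_pi_repr !lquot_scale_pi scalerA. Qed.

Fact lquot_scale1 : left_id 1 lquot_scale.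
Proof. by move=> x; rewrite -[x]lquot_pi_repr !lquot_scale_pi scale1r. Qed.

Fact lquot_scaleDr : right_distributive lquot_scale +%R.
Proof.
move=> a x y; rewrite -[x]lquot_pi_repr -[y]lquot_pi_repr.
by rewrite -lquot_piD !lquot_scale_pi -lquot_piD scalerDr.
Qed.

Fact lquot_scaleDl x : {morph lquot_scale^~ x : a b / a + b}.
Proof.
by move=> a b; rewrite -[x]lquot_pi_repr !lquot_scale_pi -lquot_piD scalerDl.
Qed.

HB.instance Definition _ := GRing.Zmodule_isLmodule.Build R (lquot S)
  lquot_scaleA lquot_scale1 lquot_scaleDr lquot_scaleDl.

Fact lquot_pi_is_linear : linear lquot_pi.
Proof. by move=> a u v; rewrite lquot_piD -lquot_scale_pi. Qed.

HB.instance Definition _ :=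
  GRing.isLinear.Build R V (lquot S) *:%R lquot_pi lquot_pi_is_linear.

End LmodQuotient.

End Subspaces.

Section SubspaceOperations.
Variables (R : pzRingType) (V : lmodType R).

Definition restr_pred (S T : submodClosed V) : {pred subspace S} :=
  fun x => val x \in T.
Arguments restr_pred S T x : clear implicits.

Fact restr_pred_closed (S T : submodClosed V) : submod_closed (restr_pred S T).
Proof.
split=> [|a x y xT yT]; rewrite unfold_in /restr_pred; first by rewrite linear0 rpred0.
by rewrite linearP rpredD ?rpredZ.
Qed.
HB.instance Definition _ (S T : submodClosed V) :=
  GRing.isSubmodClosed.Build R (subspace S) (restr_pred S T)
    (restr_pred_closed S T).

(* The quotient of S by S :&: T; it is only used for T contained in S. *)
Definition subquot (S T : submodClosed V) := lquot (restr_pred S T).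
HB.instance Definition _ (S T : submodClosed V) := GRing.Lmodule.on (subquot S T).

Definition sumset (S T : submodClosed V) : {pred V} :=
  fun v => `[< exists2 s, s \in S & exists2 t, t \in T & v = s + t >].

Fact sumset_closed (S T : submodClosed V) : submod_closed (sumset S T).
Proof.
split=> [|a _ _ /asboolP[s1 s1S [t1 t1T ->]] /asboolP[s2 s2S [t2 t2T ->]]].
  by apply/asboolP; exists 0; rewrite ?rpred0//; exists 0; rewrite ?rpred0 ?addr0.
apply/asboolP; exists (a *: s1 + s2); rewrite ?rpredD ?rpredZ//.
exists (a *: t1 + t2); rewrite ?rpredD ?rpredZ//.
by rewrite scalerDr addrACA.
Qed.
HB.instance Definition _ (S T : submodClosed V) :=
  GRing.isSubmodClosed.Build R V (sumset S T) (sumset_closed S T).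

End SubspaceOperations.
Arguments restr_pred {R V} S T x.

Definition kernel (R : pzRingType) (U V : lmodType R) (f : {linear U -> V}) :
  {pred U} := fun u => f u == 0.

Fact kernel_closed (R : pzRingType) (U V : lmodType R) (f : {linear U -> V}) :
  submod_closed (kernel f).
Proof.
split=> [|a u v]; rewrite !unfold_in ?linear0// => /eqP fu /eqP fv.
by rewrite linearP fu fv scaler0 addr0.
Qed.
HB.instance Definition _ (R : pzRingType) (U V : lmodType R)
    (f : {linear U -> V}) :=
  GRing.isSubmodClosed.Build R U (kernel f) (kernel_closed f).

Record cochain_complex (R : pzRingType) := CochainComplex {
  cc_obj :> nat -> lmodType R;
  cc_d : forall n, {linear cc_obj n -> cc_obj n.+1};
  cc_dd : forall n (x : cc_obj n), cc_d n.+1 (cc_d n x) = 0 }.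

Record cochain_map (R : pzRingType) (C D : cochain_complex R) := CochainMap {
  cm_fun :> forall n, {linear C n -> D n};
  cm_comm : forall n (x : C n), cc_d D n (cm_fun n x) = cm_fun n.+1 (cc_d C n x) }.

Section Cohomology.
Variable R : pzRingType.
Implicit Types C D : cochain_complex R.

Definition cocycle C n : {pred C n} := kernel (cc_d C n).
Arguments cocycle C n : clear implicits.
HB.instance Definition _ C n :=
  GRing.isSubmodClosed.Build R (C n) (cocycle C n) (kernel_closed (cc_d C n)).

Definition is_coboundary C n : C n -> Prop :=
  match n with
  | 0 => fun z => z = 0
  | m.+1 => fun z => exists b, z = cc_d C m b
  end.
Definition coboundary C n : {pred C n} := fun z => `[< is_coboundary z >].
Arguments coboundary C n : clear implicits.

Fact coboundary_closed C n : submod_closed (coboundary C n).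
Proof.
rewrite /coboundary; case: n => [|n]; split=> [|a u v].
- exact/asboolP.
- move=> /asboolP/= -> /asboolP/= ->.
  by apply/asboolP; rewrite /= scaler0 addr0.
- by apply/asboolP; exists 0; rewrite linear0.
- move=> /asboolP[x ->] /asboolP[y ->].
  by apply/asboolP; exists (a *: x + y); rewrite linearP.
Qed.
HB.instance Definition _ C n :=
  GRing.isSubmodClosed.Build R (C n) (coboundary C n) (coboundary_closed C n).

Lemma coboundary_cocycle C n : {subset coboundary C n <= cocycle C n}.
Proof.
case: n => [|n] z /asboolP; [|case=> b]; move=> ->; rewrite unfold_in ?linear0//.
by rewrite /kernel cc_dd.
Qed.

Definition cohomology n C := subquot (cocycle C n) (coboundary C n).
HB.instance Definition _ n C := GRing.Lmodule.on (cohomology n C).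

Section Functoriality.
Variables (C D : cochain_complex R) (f : cochain_map C D) (n : nat).

Fact cm_cocycle (z : subspace (cocycle C n)) : f n (val z) \in cocycle D n.
Proof.
by case: z => z /= /eqP dz; rewrite !unfold_in cm_comm dz linear0.
Qed.

Definition cocycle_map (z : subspace (cocycle C n)) :
  subspace (cocycle D n) := exist _ (f n (val z)) (cm_cocycle z).

Definition cohomology_map (x : cohomology n C) : cohomology n D :=
  lquot_pi _ (cocycle_map (repr x)).

Lemma cohomology_map_pi z :
  cohomology_map (lquot_pi _ z) = lquot_pi _ (cocycle_map z).
Proof.
rewrite /cohomology_map; set y := repr _.
have /lquot_piE/asboolP : lquot_pi (restr_pred (cocycle C n) (coboundary C n)) y
  = lquot_pi _ z by rewrite lquot_pi_repr.
rewrite linearB/= => yz; apply/lquot_piE/asboolP; rewrite linearB/=.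
rewrite -linearB; move: (_ - _) yz; case: n => [|m] /= u; first by move=> ->; rewrite linear0.
by case=> b ->; exists (f m b); rewrite cm_comm.
Qed.

Fact cohomology_map_is_linear : linear cohomology_map.
Proof.
move=> a x y; rewrite -[x]lquot_pi_repr -[y]lquot_pi_repr -linearP.
rewrite !cohomology_map_pi -linearP; congr lquot_pi; apply: val_inj.
by rewrite /= [LHS]linearP.
Qed.

HB.instance Definition _ := GRing.isLinear.Build R
  (cohomology n C) (cohomology n D) *:%R cohomology_map cohomology_map_is_linear.

End Functoriality.
End Cohomology.
Arguments cocycle {R} C n.
Arguments coboundary {R} C n.
Arguments cohomology_map {R C D} f n x.

Section GroupCochains.
Variables (R : realType) (G : groupType).

Definition cochain (n : nat) := n.-tuple G -> R^o.
HB.instance Definition _ n := GRing.Lmodule.on (cochain n).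

(* With 0-based indices: multiplies the entries k and k + 1 of g. *)
Definition contract n (k : 'I_n) (g : n.+1.-tuple G) : n.-tuple G :=
  [tuple if (i < k)%N then tnth g (widen_ord (leqnSn n) i)
         else if i == k then (tnth g (widen_ord (leqnSn n) i) *
                              tnth g (lift ord0 i))%g
         else tnth g (lift ord0 i) | i < n].

Definition delta n (a : cochain n) : cochain n.+1 := fun g =>
  a [tuple of behead g]
  + \sum_(k < n) (-1) ^+ k.+1 * a (contract k g)
  + (-1) ^+ n.+1 * a [tuple tnth g (widen_ord (leqnSn n) i) | i < n].

(* The faces of the bar resolution in uniform notation; only used in proofs. *)
Definition face n (k : nat) (g : n.+1.-tuple G) : n.-tuple G :=
  [tuple if (i.+1 < k)%N then nth 1%g g i
         else if i.+1 == k then (nth 1 g i * nth 1 g i.+1)%g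
         else nth 1%g g i.+1 | i < n].

Lemma nth_face n k (g : n.+1.-tuple G) i : (i < n)%N ->
  nth 1%g (face k g) i = if (i.+1 < k)%N then nth 1%g g i
         else if i.+1 == k then (nth 1 g i * nth 1 g i.+1)%g
         else nth 1%g g i.+1.
Proof.
by move=> lt_in; rewrite -[i]/(nat_of_ord (Ordinal lt_in)) -tnth_nth tnth_mktuple.
Qed.

Lemma eq_tuple_nth n (s t : n.-tuple G) :
  (forall i, (i < n)%N -> nth 1%g s i = nth 1%g t i) -> s = t.
Proof. by move=> st; apply: eq_from_tnth => i; rewrite !(tnth_nth 1%g) st. Qed.

Lemma deltaE n (a : cochain n) g :
  delta a g = \sum_(k < n.+2) (-1) ^+ k * a (face k g).
Proof.
rewrite big_ord_recl big_ord_recr/= expr0 mul1r addrA /delta.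
congr (a _ + _ + _ * a _).
- by apply: eq_tuple_nth => i lt_in; rewrite nth_face//= nth_behead.
- apply: eq_bigr => k _; congr (_ * a _).
  apply: eq_from_tnth => i; rewrite !tnth_mktuple !(tnth_nth 1%g)/=.
  by rewrite ltnS eqSS.
- apply: eq_from_tnth => i; rewrite !tnth_mktuple !(tnth_nth 1%g)/=.
  by rewrite /bump leq0n ltnS ltn_ord.
Qed.

Lemma face_face n k l (g : n.+2.-tuple G) : (l < k)%N ->
  face l (face k g) = face k.-1 (face l g).
Proof.
case: k => // k; rewrite ltnS => lk /=.
apply: eq_tuple_nth => i lt_in; rewrite !nth_face; try lia.
repeat case: ifPn => ?; try lia; rewrite ?mulgA//.
Qed.

Lemma alternating_sum0 (F : nat -> nat -> R) n :
  (forall k l, (l < k)%N -> F k l = - F l k.-1) ->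
  \sum_(k < n.+1) \sum_(l < n) F k l = 0.
Proof.
move=> HF; elim: n => [|n IHn]; first by rewrite big1// => k _; rewrite big_ord0.
rewrite big_ord_recr/=.
under eq_bigr do rewrite big_ord_recr/=.
rewrite big_split/= IHn add0r -big_split/= big1// => k _.
by rewrite [F n.+1 _]HF//= addrN.
Qed.

Lemma delta_delta n (a : cochain n) : delta (delta a) = 0.
Proof.
apply/funext => g; rewrite deltaE.
under eq_bigr do rewrite deltaE mulr_sumr.
apply: (@alternating_sum0 (fun k l =>
  (-1) ^+ k * ((-1) ^+ l * a (face l (face k g))))) => k l lk.
rewrite face_face//; case: k lk => // k _ /=.
by rewrite exprS mulN1r mulNr !mulrA -!exprD addnC.
Qed.

Fact delta_is_linear n : linear (@delta n).
Proof.
move=> c a b; apply/funext => g; rewrite /= !fctE !deltaE.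
rewrite [X in _ = X + _]mulr_sumr -big_split/=.
by apply: eq_bigr => k _; rewrite mulrDr mulrCA.
Qed.
HB.instance Definition _ n :=
  GRing.isLinear.Build R (cochain n) (cochain n.+1) *:%R (@delta n)
    (@delta_is_linear n).

Definition group_complex : cochain_complex R :=
  CochainComplex (fun n (a : cochain n) => delta_delta a).

Definition is_one_bounded n : cochain n -> Prop :=
  match n with
  | 0 => fun _ => True
  | m.+1 => fun w => forall t : m.-tuple G,
      bounded_fun (fun x : G => w [tuple of x :: t])
  end.
Definition one_bounded n : {pred cochain n} := fun w => `[< is_one_bounded w >].

Lemma bounded_funE (T : Type) (f : T -> R^o) :
  bounded_fun f <-> exists M, forall x, `|f x| <= M.
Proof.
split=> [[M [_ fM]]|[M fM]].
  by exists (M + 1) => x; apply: (fM (M + 1)); rewrite // ltrDl.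
exists M; split=> [|N MN x _]; first exact: num_real.
exact: le_trans (fM x) (ltW MN).
Qed.

Lemma bounded_fun_linear (T : Type) (f g : T -> R^o) (c : R) :
  bounded_fun f -> bounded_fun g -> bounded_fun (c *: f + g).
Proof.
move=> /bounded_funE[M fM] /bounded_funE[N gN]; apply/bounded_funE.
exists (`|c| * M + N) => x; rewrite !fctE (le_trans (ler_normD _ _))//.
by rewrite lerD// normrM ler_wpM2l.
Qed.

Lemma bounded_fun_cst (T : Type) (c : R) : bounded_fun (fun _ : T => c : R^o).
Proof. by apply/bounded_funE; exists `|c|. Qed.

Fact one_bounded_closed n : submod_closed (@one_bounded n).
Proof.
rewrite /one_bounded; case: n => [|n]; first by split=> [|? ? ? _ _]; apply/asboolP.
split=> [|c a b /asboolP Ha /asboolP Hb]; apply/asboolP => t.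
  exact: bounded_fun_cst.
exact: bounded_fun_linear.
Qed.
HB.instance Definition _ n :=
  GRing.isSubmodClosed.Build R (cochain n) (@one_bounded n)
    (@one_bounded_closed n).

Lemma delta_one_bounded n (a : cochain n) :
  a \in @one_bounded n -> delta a \in @one_bounded n.+1.
Proof.
move=> /asboolP Ha; apply/asboolP => t; apply/bounded_funE.
case: n => [|n] in a t Ha *.
  exists 0 => x; rewrite deltaE !big_ord_recl big_ord0/= /bump/= expr0 expr1.
  by rewrite [face 1 _]tuple0 [face 0 _]tuple0 mul1r addr0 mulN1r subrr normr0.
have face_cons k x : face k.+2 [tuple of x :: t] = [tuple of x :: face k.+1 t].
  apply: eq_tuple_nth => -[|i] lt_in; rewrite nth_face//.
  by rewrite -[RHS]/(nth 1%g (face k.+1 t) i) nth_face.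
have face_cons1 x : face 1 [tuple of x :: t]
    = [tuple of (x * nth 1 t 0)%g :: face 0 t].
  apply: eq_tuple_nth => -[|i] lt_in; rewrite nth_face//.
  by rewrite -[RHS]/(nth 1%g (face 0 t) i) nth_face.
have face_cons0 x : face 0 [tuple of x :: t] = t.
  by apply: eq_tuple_nth => i lt_in; rewrite nth_face.
have [M HM] : exists M : 'I_n.+3 -> (R : Type),
    forall (k : 'I_n.+3) x, `|a (face k [tuple of x :: t])| <= M k.
  suff H (k : 'I_n.+3) : {M : R | forall x, `|a (face k [tuple of x :: t])| <= M}.
    by exists (fun k => sval (H k)) => k; exact: svalP (H k).
  apply: cid; case: k => -[|[|k]] ltk /=.
  - by exists `|a t| => x; rewrite face_cons0.
  - have /bounded_funE[M aM] := Ha (face 0 t).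
    by exists M => x; rewrite face_cons1.
  - have /bounded_funE[M aM] := Ha (face k.+1 t).
    by exists M => x; rewrite face_cons.
exists (\sum_k M k) => x; rewrite deltaE (le_trans (ler_norm_sum _ _ _))//.
apply: ler_sum => k _.
by rewrite normrM normrX normrN1 expr1n mul1r.
Qed.

Definition one_bounded_cochain n := subspace (@one_bounded n).
HB.instance Definition _ n := GRing.Lmodule.on (one_bounded_cochain n).

Definition one_bounded_delta n (a : one_bounded_cochain n) :
  one_bounded_cochain n.+1 :=
  exist _ (delta (val a)) (delta_one_bounded (valP a)).

Fact one_bounded_delta_is_linear n : linear (@one_bounded_delta n).
Proof. by move=> c a b; apply: val_inj; rewrite linearP/= !linearP. Qed.
HB.instance Definition _ n := GRing.isLinear.Build R
  (one_bounded_cochain n) (one_bounded_cochain n.+1) *:%R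
  (@one_bounded_delta n) (@one_bounded_delta_is_linear n).

Fact one_bounded_delta_delta n (a : one_bounded_cochain n) :
  one_bounded_delta (one_bounded_delta a) = 0.
Proof. by apply: val_inj; rewrite /= delta_delta. Qed.

Definition one_bounded_complex : cochain_complex R :=
  CochainComplex one_bounded_delta_delta.

Definition one_bounded_inclusion : cochain_map one_bounded_complex group_complex :=
  @CochainMap R one_bounded_complex group_complex
    (fun n => (val : one_bounded_cochain n -> cochain n)) (fun n a => erefl).

Definition comparison_map n :
  {linear cohomology n one_bounded_complex -> cohomology n group_complex} :=
  cohomology_map one_bounded_inclusion n.

Definition lipschitz_funs : {pred G -> R^o} := fun f =>
  `[< forall h, bounded_fun (fun g => f (g * h)%g - f g : R^o) >].
Definition bounded_funs : {pred G -> R^o} := fun f => `[< bounded_fun f >].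
Definition hom_funs : {pred G -> R^o} := fun f =>
  `[< forall g h, f (g * h)%g = f g + f h >].

Fact lipschitz_funs_closed : submod_closed lipschitz_funs.
Proof.
split=> [|c f1 f2 /asboolP H1 /asboolP H2]; apply/asboolP => h.
  apply/bounded_funE; exists 0 => g.
  by rewrite (_ : _ - _ = 0) ?normr0//; exact: subrr.
have := bounded_fun_linear c (H1 h) (H2 h).
by congr (bounded_fun _); apply/funext => g; rewrite !fctE scalerBr addrACA opprD.
Qed.
HB.instance Definition _ := GRing.isSubmodClosed.Build R (G -> R^o)
  lipschitz_funs lipschitz_funs_closed.

Fact bounded_funs_closed : submod_closed bounded_funs.
Proof.
split=> [|c f1 f2 /asboolP H1 /asboolP H2]; apply/asboolP.
  exact: bounded_fun_cst.
exact: bounded_fun_linear.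
Qed.
HB.instance Definition _ := GRing.isSubmodClosed.Build R (G -> R^o)
  bounded_funs bounded_funs_closed.

Fact hom_funs_closed : submod_closed hom_funs.
Proof.
split=> [|c f1 f2 /asboolP H1 /asboolP H2]; apply/asboolP => g h.
  by rewrite addr0.
by rewrite !fctE H1 H2 scalerDr addrACA.
Qed.
HB.instance Definition _ := GRing.isSubmodClosed.Build R (G -> R^o)
  hom_funs hom_funs_closed.

Lemma sum_hom_bounded_lipschitz :
  {subset sumset hom_funs bounded_funs <= lipschitz_funs}.
Proof.
move=> f /asboolP[a /asboolP Ha [b /asboolP/bounded_funE[M Hb] ->]].
apply/asboolP => h; apply/bounded_funE; exists (`|a h| + (M + M)) => g.
rewrite !fctE Ha opprD addrACA [a g + _]addrC addrK.
rewrite (le_trans (ler_normD _ _))// lerD2l.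
by rewrite (le_trans (ler_normB _ _))// lerD.
Qed.

End GroupCochains.
Arguments comparison_map R G n : clear implicits.
Arguments lipschitz_funs R G : clear implicits.
Arguments bounded_funs R G : clear implicits.
Arguments hom_funs R G : clear implicits.

(* Main.v *)
From HB Require Import structures.
Require Import Defs.
Set Warnings "-all".
From mathcomp Require Import all_boot all_order all_algebra boolp functions reals.

(** A function [phi] on [G] is a 1-cochain, and its coboundary is
    [delta phi (x, h) = phi h - phi (x h) + phi x].  For fixed [h] this is
    bounded in [x] exactly when [x |-> phi (x h) - phi x] is, so [delta phi] is
    1-bounded precisely when [phi] is abstractly Lipschitz ([delta_lipschitz]).
    Hence sending [phi] to the class of [delta phi] is a linear map from the
    Lipschitz functions to the 1-bounded cohomology ([lipschitz_class]), and its
    image is the kernel of the comparison map: a 1-bounded cocycle that dies in ordinary cohomology is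
    [delta phi] for some [phi], necessarily Lipschitz
    ([lipschitz_class_onto_kernel]).

    The class of [delta phi] vanishes when [delta phi = delta psi] with [psi]
    1-bounded, which in degree one just means bounded; then [phi - psi] has zero
    coboundary, i.e. is a homomorphism.  So the kernel of this map is the sum of
    the homomorphisms and the bounded functions ([lipschitz_class_eq0]).  The
    kernel of the comparison map and the quotient in the theorem are thus two
    quotients of the Lipschitz functions by the same subspace, hence isomorphic
    ([linear_bijective_same_kernel]). *)

Set Implicit Arguments.
Unset Strict Implicit.
Unset Printing Implicit Defensive.

Import Order.TTheory GRing.Theory Num.Theory.
Local Open Scope ring_scope.

(** The isomorphism sends [p u] to [q u]; equality of the kernels makes this
    both well defined and injective. *)
Lemma linear_bijective_same_kernel (R : pzRingType) (U W W' : lmodType R)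
    (p : {linear U -> W}) (q : {linear U -> W'}) :
    (forall w, exists u, p u = w) -> (forall w, exists u, q u = w) ->
    (forall u, p u = 0 <-> q u = 0) ->
  exists f : {linear W -> W'}, bijective f.
Proof.
move=> p_onto q_onto ker_pq.
have eq_pq u v : p u = p v <-> q u = q v.
  have [pq qp] := ker_pq (u - v).
  split=> /eqP; rewrite -subr_eq0 -linearB/= => /eqP.
    by move=> /pq/eqP; rewrite linearB subr_eq0 => /eqP.
  by move=> /qp/eqP; rewrite linearB subr_eq0 => /eqP.
pose s w := projT1 (cid (p_onto w)).
have sK w : p (s w) = w := projT2 (cid (p_onto w)).
pose s' w := projT1 (cid (q_onto w)).
have s'K w : q (s' w) = w := projT2 (cid (q_onto w)).
pose f w := q (s w).
have f_lin : linear f.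
  by move=> a v w; rewrite /f -linearP; apply/eq_pq; rewrite linearP !sK.
pose f_linM := GRing.isLinear.Build R W W' *:%R f f_lin.
pose F : {linear W -> W'} := HB.pack f f_linM.
exists F; exists (fun w => p (s' w)) => w /=.
  by rewrite -[RHS]sK; apply/eq_pq; rewrite s'K.
by rewrite /f -[RHS]s'K; apply/eq_pq; rewrite sK.
Qed.

Lemma lquot_pi_eq0 (R : pzRingType) (V : lmodType R) (S : submodClosed V) v :
  (lquot_pi S v = 0) <-> (v \in S).
Proof.
rewrite -(linear0 (lquot_pi S)); split=> [/lquot_piE|vS]; first by rewrite subr0.
by apply/lquot_piE; rewrite subr0.
Qed.

Section LipschitzClass.
Variables (R : realType) (G : groupType).
Implicit Types phi psi : G -> R^o.

Definition cochain1 phi : cochain R G 1 := fun t => phi (thead t).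

Lemma cochain1_surj (a : cochain R G 1) : exists phi, a = cochain1 phi.
Proof.
exists (fun x => a [tuple x]); apply/funext => t.
by congr (a _); apply: eq_from_tnth => i; rewrite ord1 tnth0.
Qed.

Lemma delta_cochain1 phi (x : G) (t : 1.-tuple G) :
  delta (cochain1 phi) [tuple of x :: t]
    = phi (thead t) - phi (x * thead t)%g + phi x.
Proof.
rewrite deltaE !big_ord_recl big_ord0 /= /bump /= expr0 expr1 !addn1/=.
rewrite addr0 mul1r mulN1r addrA sqrrN expr1n mul1r.
by rewrite /cochain1 /thead !tnth_mktuple /= !(tnth_nth 1%g).
Qed.

(** Boundedness of the first variable of [delta phi] is the Lipschitz
    condition up to the constant [phi h]. *)
Lemma delta_lipschitz phi :
  (delta (cochain1 phi) \in one_bounded (n := 2)) = (phi \in lipschitz_funs R G).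
Proof.
apply/asboolP/asboolP => /= H.
  move=> h; have /bounded_funE[M HM] := H [tuple h].
  apply/bounded_funE; exists (M + `|phi h|) => x.
  have := HM x; rewrite delta_cochain1 (_ : thead _ = h)// => Hx.
  rewrite (_ : _ - _ = - (phi h - phi (x * h)%g + phi x) + phi h).
    by rewrite (le_trans (ler_normD _ _))// normrN lerD.
  by rewrite opprD opprB [in RHS]addrAC subrK.
move=> t; have /bounded_funE[M HM] := H (thead t).
apply/bounded_funE; exists (`|phi (thead t)| + M) => x.
rewrite delta_cochain1 -addrA (le_trans (ler_normD _ _))// lerD2l.
by rewrite addrC distrC.
Qed.

(** In degree one, a cochain has only the variable that is required to be
    bounded. *)
Lemma cochain1_one_bounded phi :
  (cochain1 phi \in one_bounded (n := 1)) = (phi \in bounded_funs R G).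
Proof.
by apply/asboolP/asboolP => /= [/(_ [tuple])|H t].
Qed.

Lemma delta_cochain1_eq0 phi :
  delta (cochain1 phi) = 0 <-> phi \in hom_funs R G.
Proof.
split=> [d0|/asboolP hom].
  apply/asboolP => g h.
  have := delta_cochain1 phi g [tuple h]; rewrite d0 (_ : thead _ = h)//.
  move=> /esym/eqP; rewrite addrAC subr_eq0 => /eqP <-.
  by rewrite addrC.
apply/funext => t; rewrite (tuple_eta t) delta_cochain1 hom.
by rewrite opprD addrA addrAC subrK subrr.
Qed.

Lemma cochain1_is_linear : linear cochain1.
Proof. by []. Qed.

HB.instance Definition _ := GRing.isLinear.Build R (G -> R^o)
  (cochain R G 1) *:%R cochain1 cochain1_is_linear.

Notation H1b := (cohomology 2 (one_bounded_complex R G)).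
Notation Lip := (subspace (lipschitz_funs R G)).

Fact lipschitz_delta_one_bounded (phi : Lip) :
  delta (cochain1 (val phi)) \in one_bounded (n := 2).
Proof. by rewrite delta_lipschitz; exact: valP phi. Qed.

Definition lipschitz_coboundary (phi : Lip) : one_bounded_cochain R G 2 :=
  exist _ (delta (cochain1 (val phi))) (lipschitz_delta_one_bounded phi).

Fact lipschitz_coboundary_cocycle (phi : Lip) :
  lipschitz_coboundary phi \in cocycle (one_bounded_complex R G) 2.
Proof. by apply/eqP/val_inj; rewrite /= delta_delta. Qed.

Definition lipschitz_cocycle (phi : Lip) :
    subspace (cocycle (one_bounded_complex R G) 2) :=
  exist _ (lipschitz_coboundary phi) (lipschitz_coboundary_cocycle phi).

Definition lipschitz_class (phi : Lip) : H1b :=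
  lquot_pi _ (lipschitz_cocycle phi).

Fact lipschitz_class_is_linear : linear lipschitz_class.
Proof.
move=> a u v; rewrite /lipschitz_class -linearP; congr lquot_pi.
by do 2 apply: val_inj; rewrite /= !linearP.
Qed.

(** [delta phi] may fail to be the coboundary of a 1-bounded cochain, but it is
    always the coboundary of [phi]. *)
Fact lipschitz_class_kernel (phi : Lip) :
  lipschitz_class phi \in kernel (comparison_map R G 2).
Proof.
apply/eqP; rewrite /comparison_map /= cohomology_map_pi.
by apply/lquot_pi_eq0/asboolP; exists (cochain1 (val phi)).
Qed.

Definition lipschitz_kernel_class (phi : Lip) :
    subspace (kernel (comparison_map R G 2)) :=
  exist _ (lipschitz_class phi) (lipschitz_class_kernel phi).

Fact lipschitz_kernel_class_is_linear : linear lipschitz_kernel_class.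
Proof.
by move=> a u v; apply: val_inj; rewrite linearP /= lipschitz_class_is_linear.
Qed.

HB.instance Definition _ := GRing.isLinear.Build R Lip
  (subspace (kernel (comparison_map R G 2))) *:%R lipschitz_kernel_class
  lipschitz_kernel_class_is_linear.

(** Every 1-cochain is a function on the group, so a primitive of a
    representing cocycle is already the required function; the 1-boundedness of
    the cocycle makes it Lipschitz. *)
Lemma lipschitz_class_onto_kernel (x : subspace (kernel (comparison_map R G 2))) :
  exists phi : Lip, lipschitz_kernel_class phi = x.
Proof.
pose z := repr (val x); have zx : lquot_pi _ z = val x := lquot_pi_repr (val x).
have : comparison_map R G 2 (lquot_pi _ z) = 0 by rewrite zx; apply/eqP; exact: valP x.
rewrite /comparison_map /= cohomology_map_pi => /lquot_pi_eq0/asboolP[a /= da].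
have [phi a_phi] := cochain1_surj a; rewrite a_phi in da.
have phi_lip : phi \in lipschitz_funs R G.
  by rewrite -delta_lipschitz -da; exact: valP (val z).
exists (exist _ phi phi_lip); apply: val_inj; rewrite /= -zx.
by congr lquot_pi; do 2 apply: val_inj; rewrite /= da.
Qed.

(** Two primitives of the same 2-cocycle differ by a 1-cocycle, that is, by a
    homomorphism. *)
Lemma lipschitz_class_eq0 (phi : Lip) :
  lipschitz_class phi = 0 <->
  val phi \in sumset (hom_funs R G) (bounded_funs R G).
Proof.
split=> [/lquot_pi_eq0/asboolP[b /(congr1 val)/= phi_b]|/asboolP[a a_hom [b b_bnd phi_ab]]].
  have [psi b_psi] := cochain1_surj (val b).
  apply/asboolP; exists (val phi - psi); last first.
    exists psi; last by rewrite subrK.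
    by rewrite -cochain1_one_bounded -b_psi; exact: valP.
  by apply/delta_cochain1_eq0; rewrite (linearB cochain1) (linearB (@delta R G 1)) /= phi_b b_psi subrr.
have b_bnd' : cochain1 b \in one_bounded (n := 1) by rewrite cochain1_one_bounded.
apply/lquot_pi_eq0/asboolP; exists (exist _ (cochain1 b) b_bnd').
apply: val_inj; rewrite /= phi_ab (linearD cochain1) (linearD (@delta R G 1)) /=.
by have /delta_cochain1_eq0 -> := a_hom; rewrite add0r.
Qed.

End LipschitzClass.

Theorem proposition4p1 (R : realType) (G : groupType) :
  exists f : {linear subspace (kernel (comparison_map R G 2)) ->
                     subquot (lipschitz_funs R G)
                             (sumset (hom_funs R G) (bounded_funs R G))},
    bijective f.
Proof.
apply: (linear_bijective_same_kernel (p := @lipschitz_kernel_class R G)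
  (q := lquot_pi (restr_pred _ _))).
- exact: lipschitz_class_onto_kernel.
- by move=> w; exists (repr w); exact: lquot_pi_repr.
move=> phi; rewrite lquot_pi_eq0 -[X in _ <-> X]lipschitz_class_eq0.
by split=> [/(congr1 val)|phi0]; [|apply: val_inj].
Qed.
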